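(* Every finite sequence on the symbols $0$ and $1$ appears as an arithmetic subsequence of the Thue--Morse sequence $\mathbf t$. That is, for every integer $L\ge 1$ and every $\omega=(\omega_0,\ldots,\omega_{L-1})\in\{0,1\}^L$ there exist integers $d\ge 1$ and $j\ge 0$ such that $\mathbf t_{\ell d+j}=\omega_\ell$ for all $0\le \ell<L$.
   Context: The Thue--Morse sequence $\mathbf t=(\mathbf t_n)_{n\ge 0}$ is defined by $\mathbf t_n=0$ if $s(n)$ is even and $\mathbf t_n=1$ if $s(n)$ is odd, where $s(n)$ is the number of $1$s in the binary expansion of $n$. *)

(* Defs.v *)
From mathcomp Require Import all_boot.
Set Implicit Arguments.
Unset Strict Implicit.
Unset Printing Implicit Defensive.

Definition binary_digit (n i : nat) : nat := (n %/ 2 ^ i) %% 2.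

(* The range i < n covers the whole binary expansion, since n < 2 ^ n. *)
Definition sum_binary_digits (n : nat) : nat := \sum_(i < n) binary_digit n i.

(* The symbols 0 and 1 are represented by false and true. *)
Definition thue_morse (n : nat) : bool := odd (sum_binary_digits n).

(* Main.v *)
Require Import Defs.
From mathcomp Require Import all_boot.
From mathcomp Require Import zify.

(** Work with words [w] such that [t (l * d + j) = w l] for [l < L]. They form
    a subspace of F_2^L: placing a second pair [(d', j')] in digit positions
    above all those used by the first adds (mod 2) the two words. For large [N],
    [l + 2 ^ N - c] and [l + 2 ^ N.+1 - c] have digit sums of equal parity when
    [c <= l] and of opposite parity when [l < c], so the subspace contains the
    indicators of the initial segments, which span F_2^L. *)

Lemma sum_binary_digits_widen n m :
  n <= m -> sum_binary_digits n = \sum_(i < m) binary_digit n i.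
Proof.
move=> le_nm; rewrite /sum_binary_digits (big_ord_widen m (binary_digit n) le_nm).
rewrite [RHS](bigID (fun i : 'I_m => i < n)) /= [X in _ = _ + X]big1 ?addn0 //.
move=> i; rewrite -leqNgt => le_ni.
by rewrite /binary_digit divn_small // (leq_ltn_trans le_ni) // ltn_expl.
Qed.

(** No carry occurs: [a] fills the lowest [N] binary positions and [b] those above, so the digit
    sums add. *)
Lemma thue_morse_cat N a b : a < 2 ^ N ->
  thue_morse (a + b * 2 ^ N) = thue_morse a (+) thue_morse b.
Proof.
move=> lt_aN; pose m := a + b * 2 ^ N.
have le_bm : b <= m by rewrite (leq_trans _ (leq_addl _ _)) // leq_pmulr ?expn_gt0.
rewrite /thue_morse (sum_binary_digits_widen _ (N + m)) ?leq_addl //.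
rewrite (sum_binary_digits_widen a (N + m)); last first.
  by rewrite (leq_trans (leq_addr (b * 2 ^ N) a)) // leq_addl.
rewrite (sum_binary_digits_widen _ _ le_bm) -oddD !(@big_split_ord _ _ _ N) /= -addnA.
congr (odd (_ + _)).
  apply: eq_bigr => i _; rewrite /binary_digit /=.
  (* For [i < N], [b * 2 ^ N] is an even multiple of [2 ^ i], so digit [i] is that of [a]. *)
  have -> : 2 ^ N = 2 ^ (N - i.+1) * 2 * 2 ^ i.
    by rewrite -mulnA -expnS -expnD subnK.
  by rewrite mulnA divnDMl ?expn_gt0 // mulnA addnC modnMDl.
rewrite [X in _ = X + _]big1 => [|i _]; last first.
  by rewrite /binary_digit /= expnD divnMA (divn_small lt_aN) div0n.
by apply: eq_bigr => i _; rewrite /binary_digit /= expnD divnMA divnDMl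
  ?expn_gt0 // (divn_small lt_aN).
Qed.

Definition arithmetic_subword (L : nat) (w : nat -> bool) : Prop :=
  exists d j : nat, 1 <= d /\ forall l, l < L -> thue_morse (l * d + j) = w l.

Lemma eq_arithmetic_subword L w w' :
  (forall l, l < L -> w l = w' l) ->
  arithmetic_subword L w -> arithmetic_subword L w'.
Proof.
by move=> eq_w [d [j [d_gt0 w_dj]]]; exists d, j; split=> // l ltlL; rewrite w_dj ?eq_w.
Qed.

Lemma arithmetic_subword_addb L w w' :
  arithmetic_subword L w -> arithmetic_subword L w' ->
  arithmetic_subword L (fun l => w l (+) w' l).
Proof.
move=> [d [j [d_gt0 w_dj]]] [d' [j' [_ w_dj']]].
(* For [l < L], [l * d + j <= N < 2 ^ N], so the first progression stays below position [N]. *)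
pose N := L * d + j; exists (d + d' * 2 ^ N), (j + j' * 2 ^ N).
split=> [|l ltlL]; first by rewrite ltn_addr.
have -> : l * (d + d' * 2 ^ N) + (j + j' * 2 ^ N)
        = l * d + j + (l * d' + j') * 2 ^ N by lia.
rewrite thue_morse_cat ?w_dj ?w_dj' // (leq_ltn_trans _ (ltn_expl N _)) //.
by rewrite leq_add2r leq_mul2r (ltnW ltlL) orbT.
Qed.

Lemma arithmetic_subword_initial L c : arithmetic_subword L (fun l => l < c).
Proof.
pose N := L + c; have ltN : L + c < 2 ^ N by apply: ltn_expl.
have shift M : arithmetic_subword L (fun l => thue_morse (l + (2 ^ M - c))).
  by exists 1, (2 ^ M - c); split=> // l _; rewrite muln1.
apply: eq_arithmetic_subword (arithmetic_subword_addb _ _ _ (shift N) (shift N.+1)).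
move=> l ltlL; have [ltlc|lecl] := ltnP l c.
  (* As [l < c], the first shift stays below [2 ^ N]; the second has one more digit 1, at position
     [N]. *)
  have -> : l + (2 ^ N.+1 - c) = l + (2 ^ N - c) + 1 * 2 ^ N by rewrite expnS; lia.
  rewrite thue_morse_cat; last by lia.
  by rewrite addKb /thue_morse /sum_binary_digits big_ord1.
(* The high parts 1 and 2 both have digit sum 1, so the two values cancel. *)
have -> : l + (2 ^ N - c) = l - c + 1 * 2 ^ N by lia.
have -> : l + (2 ^ N.+1 - c) = l - c + 2 * 2 ^ N by rewrite expnS; lia.
rewrite !thue_morse_cat; try lia.
by rewrite addbACA addbb /thue_morse /sum_binary_digits big_ord1 big_ord_recl big_ord1.
Qed.

(** Induction on [c], for all [w]. If [w c] is true, adding the indicator of [l <= c] sets letter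
    [c] but complements the earlier ones, so the induction hypothesis is applied to the complement
    of [w]. *)
Lemma arithmetic_subword_prefix L c w :
  arithmetic_subword L (fun l => (l < c) && w l).
Proof.
elim: c w => [|c IHc] w; first exact: (arithmetic_subword_initial L 0).
have [wc|wc] := boolP (w c).
  apply: eq_arithmetic_subword (arithmetic_subword_addb _ _ _
    (IHc (fun l => ~~ w l)) (arithmetic_subword_initial L c.+1)) => l _.
  rewrite /= ltnS [l <= c]leq_eqVlt; case: eqP => [->|_]; first by rewrite ltnn wc.
  by case: (l < c); case: (w l).
apply: eq_arithmetic_subword (IHc w) => l _.
by rewrite ltnS [l <= c]leq_eqVlt; case: eqP => [->|//]; rewrite ltnn (negbTE wc).
Qed.

Theorem corollary2p3 (L : nat) (hL : 1 <= L) (omega : L.-tuple bool) :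
  exists d j : nat,
    1 <= d /\ forall l : 'I_L, thue_morse (l * d + j) = tnth omega l.
Proof.
(* With cutoff [L] all letters are kept, and the default [false] is never read. *)
have [d [j [d_gt0 omega_dj]]] := arithmetic_subword_prefix L L (nth false omega).
by exists d, j; split=> // l; rewrite omega_dj // ltn_ord (tnth_nth false).
Qed.
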